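(* Let $C_{\mathrm{pave}}>0$ be the universal constant described in the context. Let $A$ be a standardized real or complex $n\times d$ matrix with full column rank, and let $T$ be an $(m,\alpha,\beta)$ row paving of $A$ with $$m\le 4\,C_{\mathrm{pave}}\,\|A\|^2\log(1+n)\qquad\text{and}\qquad \tfrac12\le\alpha\le\beta\le\tfrac32 .$$ Let $b$ be a vector of dimension $n$, let $x_\star$ be the unique minimizer of $\|Ax-b\|_2^2$, and let $e:=Ax_\star-b$. Then for any initial estimate $x_0$, the iterates $\{x_j:j\ge0\}$ of the randomized block Kaczmarz method with matrix $A$, right-hand side $b$, partition $T$ and initial iterate $x_0$ satisfy, for every $j\ge0$, $$ \mathbb{E}\,\|x_j-x_\star\|_2^2\;\le\;\left[1-\frac{1}{6\,C_{\mathrm{pave}}\,\kappa^2(A)\,\log(1+n)}\right]^{j}\|x_0-x_\star\|_2^2\;+\;\frac{3\,\|e\|_2^2}{\sigma_{\min}^2(A)} . $$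
   Context: A matrix $A$ is standardized when each of its rows has $\ell_2$ norm equal to $1$. $\|A\|$ is the spectral norm, $\sigma_{\max}(A)$ and $\sigma_{\min}(A)$ are the largest and smallest singular values, and $\kappa(A):=\sigma_{\max}(A)/\sigma_{\min}(A)$. For an index set $\tau\subset\{1,\dots,n\}$, $A_\tau$ is the row submatrix of $A$ indexed by $\tau$, and $b_\tau$ is the subvector of $b$ with components in $\tau$. The symbol $\dagger$ denotes the Moore--Penrose pseudoinverse and $*$ the conjugate transpose. Row paving: an $(m,\alpha,\beta)$ row paving of $A$ is a partition $T=\{\tau_1,\dots,\tau_m\}$ of the row indices $\{1,\dots,n\}$ such that $\alpha\le\lambda_{\min}(A_\tau A_\tau^* )$ and $\lambda_{\max}(A_\tau A_\tau^* )\le\beta$ for each $\tau\in T$. The constant $C_{\mathrm{pave}}$: it is a positive universal constant (independent of all parameters) with the following property, known from the paving literature: for every $\delta\in(0,1)$, every standardized matrix $A$ with $n$ rows admits an $(m,\alpha,\beta)$ row paving with $m\le C_{\mathrm{pave}}\,\delta^{-2}\|A\|^2\log(1+n)$ and $1-\delta\le\alpha\le\beta\le1+\delta$. The row paving $T$ in the claim is the one guaranteed by this property with $\delta=1/2$. Randomized block Kaczmarz method: start from a fixed $x_0$. At each iteration $j=1,2,\dots$, independently of all previous choices, draw a block $\tau=\tau(j)$ uniformly at random from $T$ and set $$x_j = x_{j-1}+(A_\tau)^\dagger\,(b_\tau-A_\tau x_{j-1}).$$ The sequence of iterates is considered without applying any stopping criterion. The expectation is over the random block choices. *)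

(* Defs.v *)
From HB Require Import structures.
From mathcomp Require Import all_boot all_order all_algebra finmap.
From mathcomp Require Import all_classical all_reals all_analysis.
From mathcomp Require Import complex.

Set Implicit Arguments.
Unset Strict Implicit.
Unset Printing Implicit Defensive.

Import Order.TTheory GRing.Theory Num.Theory.

Local Open Scope classical_set_scope.
Local Open Scope ring_scope.
Local Open Scope complex_scope.
Local Open Scope sesquilinear_scope.

(* Scalars are the complex numbers [R[i]] over a [realType] [R].  A real
   matrix or vector is one whose entries are all real; every quantity below
   (norms, eigenvalues of Hermitian matrices, singular values, pseudoinverse,
   block Kaczmarz iterates) then agrees with its purely real counterpart.
   [M ^t*] is the conjugate transpose. *)

Section Matrices.
Variable R : realType.
Local Notation C := R[i].

Definition l2norm n (v : 'cV[C]_n) : R :=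
  Num.sqrt (\sum_i ComplexField.Normc.normc (v i 0) ^+ 2).

Definition standardized n d (A : 'M[C]_(n, d)) : Prop :=
  forall i, l2norm (row i A)^T = 1.

Definition spectral_norm n d (A : 'M[C]_(n, d)) : R :=
  sup [set l2norm (A *m x) | x in [set x | l2norm x <= 1]].

(* With both singular vectors required, this gives the min(n, d) singular
   values of an n x d matrix, without spurious zeros coming from the kernel of
   the larger of the two Gram matrices. *)
Definition singular_value n d (A : 'M[C]_(n, d)) (s : R) : Prop :=
  0 <= s /\ exists (u : 'cV[C]_n) (v : 'cV[C]_d),
    [/\ l2norm u = 1, l2norm v = 1, A *m v = s%:C *: u & A ^t* *m u = s%:C *: v].

Definition sigma_max n d (A : 'M[C]_(n, d)) : R :=
  sup [set s | singular_value A s].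

Definition sigma_min n d (A : 'M[C]_(n, d)) : R :=
  inf [set s | singular_value A s].

Definition kappa n d (A : 'M[C]_(n, d)) : R := sigma_max A / sigma_min A.

(* Only used for Hermitian matrices, all of whose eigenvalues are real. *)
Definition lambda_min n (M : 'M[C]_n) : R :=
  inf [set a : R | eigenvalue M a%:C].

Definition lambda_max n (M : 'M[C]_n) : R :=
  sup [set a : R | eigenvalue M a%:C].

(* Rows indexed by [tau]; also applies to column vectors. *)
Definition rowblock n d (tau : {set 'I_n}) (A : 'M[C]_(n, d)) :
    'M[C]_(#|tau|, d) :=
  rowsub (fun k : 'I_#|tau| => enum_val k) A.

Definition is_pseudoinverse n d (A : 'M[C]_(n, d)) (X : 'M[C]_(d, n)) : Prop :=
  [/\ A *m X *m A = A, X *m A *m X = X,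
      (A *m X) ^t* = A *m X & (X *m A) ^t* = X *m A].

(* The Moore-Penrose pseudoinverse exists and is unique, so the default value
   of [xget] is never used. *)
Definition pseudoinverse n d (A : 'M[C]_(n, d)) : 'M[C]_(d, n) :=
  xget 0 [set X | is_pseudoinverse A X].

Definition row_paving n d (A : 'M[C]_(n, d)) (m : nat) (alpha beta : R)
    (T : {set {set 'I_n}}) : Prop :=
  [/\ finset.partition T [set: 'I_n]%SET, #|T| = m &
      forall tau : {set 'I_n}, tau \in T ->
        let B := rowblock tau A in
        alpha <= lambda_min (B *m B ^t*) /\ lambda_max (B *m B ^t*) <= beta].

Definition paving_constant (Cpave : R) : Prop :=
  0 < Cpave /\
  forall (delta : R) (n d : nat) (A : 'M[C]_(n, d)),
    0 < delta < 1 -> standardized A ->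
    exists (m : nat) (alpha beta : R) (T : {set {set 'I_n}}),
      [/\ row_paving A m alpha beta T,
          m%:R <= Cpave * delta ^- 2 * spectral_norm A ^+ 2 * ln (1 + n%:R) &
          1 - delta <= alpha <= beta /\ beta <= 1 + delta].

Definition least_squares_minimizer n d (A : 'M[C]_(n, d)) (b : 'cV[C]_n)
    (x : 'cV[C]_d) : Prop :=
  forall y : 'cV[C]_d, l2norm (A *m x - b) ^+ 2 <= l2norm (A *m y - b) ^+ 2.

(* [tau j] is the block drawn at iteration [j.+1]. *)
Fixpoint block_kaczmarz n d (A : 'M[C]_(n, d)) (b : 'cV[C]_n) (x0 : 'cV[C]_d)
    (tau : nat -> {set 'I_n}) (j : nat) : 'cV[C]_d :=
  if j is j'.+1 then
    let x := block_kaczmarz A b x0 tau j' in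
    x + pseudoinverse (rowblock (tau j') A)
          *m (rowblock (tau j') b - rowblock (tau j') A *m x)
  else x0.

End Matrices.

(* [tau] is a sequence of independent random elements, each uniformly
   distributed on the finite set [T]; the values live in a finite type, all of
   whose subsets are taken to be measurable. *)
Definition iid_uniform d (Omega : measurableType d) (R : realType)
    (P : probability Omega R) (S : finType) (T : {set S})
    (tau : nat -> Omega -> S) : Prop :=
  [/\ forall (j : nat) (B : set S), measurable (tau j @^-1` B),
      forall (j : nat) (t : S), t \in T ->
        P (tau j @^-1` [set t]) = ((#|T|%:R)^-1)%:E &
      forall (J : {fset nat}) (B : nat -> set S),
        P (\bigcap_(j in [set` J]) (tau j @^-1` B j)) =
        (\prod_(j <- J) P (tau j @^-1` B j))%E].

(* Main.v *)
Require Import Defs.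
From HB Require Import structures.
From mathcomp Require Import all_boot all_order all_algebra finmap.
From mathcomp Require Import all_classical all_reals all_analysis.
From mathcomp Require Import measurable_realfun complex.
From mathcomp Require Import ring lra.

(** The error [u = x - xstar] before a step with block [tau], [B] the rows of
    [A] in [tau] and [X] the pseudoinverse of [B], becomes
    [u - X *m (B *m u) + X *m f], where [f] is the part in [tau] of the residual
    [b - A *m xstar].  Since [X *m B] is the orthogonal projection onto the range
    of [X], the two contributions are orthogonal and Pythagoras separates them
    ([block_update_le]): the paving bounds [alpha] and [beta] on the spectrum of
    [B *m B ^t*] give that the projection removes at least [|B u|^2 / beta] from
    [|u|^2] and that the noise term costs at most [|f|^2 / alpha].

    The blocks partition the rows, so summing over the paving turns [|B u|^2]
    into [|A u|^2 >= sigma_min^2 |u|^2] and [|f|^2] into the full squared residual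
    [|e|^2] ([paving_step_sum]).  Dividing by the number [m] of blocks, one step
    changes the expected squared error [D] to at most
    [q * D + (1 - q) * N], with [q = 1 - sigma_min^2 / (beta m)] and
    [N = (beta / alpha) |e|^2 / sigma_min^2].  Iterating this affine contraction
    gives [q ^ j * D + (1 - q ^ j) * N] after [j] steps
    ([iterated_contraction]).  Here [beta / alpha <= 3], and the bound on [m]
    gives [beta m <= 6 Cpave sigma_max^2 log (1 + n)], which turns [q] into the
    rate of the theorem.

    Two supporting facts are of another nature.  The extremal eigenvalues and
    singular values are an infimum and a supremum of sets of reals; they bound
    quadratic forms because a unitary diagonalization identifies these sets with
    the finite list of diagonal entries ([lambda_min_le], [lambda_max_ge],
    [singular_values_bounds]).  The expectation over the random
    blocks is a finite sum over the tuples of the first [j] draws, weighted by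
    products of uniform weights ([expectation_draws]); the contraction is then
    iterated on that sum, conditioning on the first draw. *)

Set Implicit Arguments.
Unset Strict Implicit.
Unset Printing Implicit Defensive.

Import Order.TTheory GRing.Theory Num.Theory.

Local Open Scope ring_scope.

(** * The real inner product on complex vectors *)

Section RealInnerProduct.
Local Open Scope classical_set_scope.
Local Open Scope complex_scope.
Local Open Scope sesquilinear_scope.
Variable R : realType.
Local Notation C := R[i].

(** The real inner product of [C^n] seen as a real vector space.  Its norm is
    [l2norm] and its adjoints are conjugate transposes, so the whole argument
    becomes arithmetic of real numbers. *)
Definition rdot n (u v : 'cV[C]_n) : R := complex.Re ((u ^t* *m v) 0 0).

Lemma trmxCM m n p (A : 'M[C]_(m, n)) (B : 'M[C]_(n, p)) :
  (A *m B) ^t* = B ^t* *m A ^t*.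
Proof. by rewrite trmx_mul map_mxM. Qed.

Lemma trmxC1 n : (1%:M : 'M[C]_n) ^t* = 1%:M.
Proof. by rewrite trmx1 map_mx1. Qed.

Lemma rdotE n (u v : 'cV[C]_n) :
  rdot u v = \sum_i complex.Re ((u i 0)^* * v i 0)%C.
Proof.
rewrite /rdot mxE raddf_sum; apply: eq_bigr => i _.
by rewrite !mxE.
Qed.

Lemma rdotC n (u v : 'cV[C]_n) : rdot u v = rdot v u.
Proof.
rewrite !rdotE; apply: eq_bigr => i _.
by case: (u i 0) => a b; case: (v i 0) => c d /=; ring.
Qed.

Lemma rdotDr n (u v w : 'cV[C]_n) : rdot u (v + w) = rdot u v + rdot u w.
Proof. by rewrite /rdot mulmxDr mxE raddfD. Qed.

Lemma rdotNr n (u v : 'cV[C]_n) : rdot u (- v) = - rdot u v.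
Proof. by rewrite /rdot mulmxN mxE raddfN. Qed.

Lemma rdotZr n (a : R) (u v : 'cV[C]_n) : rdot u (a%:C *: v) = a * rdot u v.
Proof.
rewrite /rdot -scalemxAr mxE.
by case: ((u ^t* *m v) 0 0) => c d /=; ring.
Qed.

Lemma rdotDl n (u v w : 'cV[C]_n) : rdot (v + w) u = rdot v u + rdot w u.
Proof. by rewrite !(rdotC _ u) rdotDr. Qed.

Lemma rdotNl n (u v : 'cV[C]_n) : rdot (- v) u = - rdot v u.
Proof. by rewrite !(rdotC _ u) rdotNr. Qed.

Lemma rdotZl n (a : R) (u v : 'cV[C]_n) : rdot (a%:C *: v) u = a * rdot v u.
Proof. by rewrite !(rdotC _ u) rdotZr. Qed.

Lemma rdot0r n (u : 'cV[C]_n) : rdot u 0 = 0.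
Proof. by rewrite /rdot mulmx0 mxE. Qed.

Lemma rdot0l n (u : 'cV[C]_n) : rdot 0 u = 0.
Proof. by rewrite rdotC rdot0r. Qed.

Lemma rdot_adj m n (A : 'M[C]_(m, n)) u v :
  rdot u (A *m v) = rdot (A ^t* *m u) v.
Proof. by rewrite /rdot trmxCM trmxCK mulmxA. Qed.

Lemma l2norm_sqr n (v : 'cV[C]_n) : l2norm v ^+ 2 = rdot v v.
Proof.
have nc0 i : 0 <= ComplexField.Normc.normc (v i 0) ^+ 2 by rewrite sqr_ge0.
rewrite /l2norm sqr_sqrtr; last by rewrite sumr_ge0.
rewrite rdotE; apply: eq_bigr => i _.
case: (v i 0) => a b /=; rewrite sqr_sqrtr ?addr_ge0 ?sqr_ge0 //; ring.
Qed.

Lemma l2norm_ge0 n (v : 'cV[C]_n) : 0 <= l2norm v.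
Proof. exact: sqrtr_ge0. Qed.

Lemma l2norm_rdot n (v : 'cV[C]_n) : l2norm v = Num.sqrt (rdot v v).
Proof. by rewrite -l2norm_sqr sqrtr_sqr ger0_norm ?l2norm_ge0. Qed.

Lemma rdot_ge0 n (v : 'cV[C]_n) : 0 <= rdot v v.
Proof. by rewrite -l2norm_sqr sqr_ge0. Qed.

Lemma rdot_eq0 n (v : 'cV[C]_n) : rdot v v = 0 -> v = 0.
Proof.
rewrite -l2norm_sqr => /eqP; rewrite sqrf_eq0 /l2norm sqrtr_eq0 => h.
have nc0 (i : 'I_n) : true -> 0 <= ComplexField.Normc.normc (v i 0) ^+ 2.
  by rewrite sqr_ge0.
have /eqP h0 : \sum_i ComplexField.Normc.normc (v i 0) ^+ 2 == 0.
  by rewrite eq_le h sumr_ge0.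
apply/colP => i; rewrite mxE; apply: ComplexField.Normc.eq0_normc.
by apply/eqP; rewrite -sqrf_eq0; apply/eqP; apply: (psumr_eq0P nc0 h0).
Qed.

End RealInnerProduct.

(** * Quadratic forms of Hermitian matrices *)

Section Spectral.
Local Open Scope classical_set_scope.
Local Open Scope complex_scope.
Local Open Scope sesquilinear_scope.
Variable R : realType.
Local Notation C := R[i].

Lemma hermitian_diagonalization n (M : 'M[C]_n) : M ^t* = M ->
  exists (U : 'M[C]_n) (d : 'I_n -> R),
    [/\ U *m U ^t* = 1%:M, U ^t* *m U = 1%:M &
        U *m M = diag_mx (\row_i (d i)%:C) *m U].
Proof.
move=> hM; have hH : M \is hermsymmx.
  by apply/is_hermitianmxP; rewrite expr0 scale1r hM.
have UU := spectral_unitarymx M; set U := spectralmx M in UU *.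
have UUt : U *m U ^t* = 1%:M by apply/unitarymxP.
have UtU : U ^t* *m U = 1%:M by rewrite -invmx_unitary // mulVmx ?unitarymx_unit.
exists U, (fun i => complex.Re (spectral_diag M 0 i)); split => //.
have /orthomx_spectralP := hermitian_normalmx hH; rewrite -/U => Me.
have -> : \row_i (complex.Re (spectral_diag M 0 i))%:C = spectral_diag M.
  apply/rowP => i; rewrite mxE; apply: RRe_real.
  by have /mxOverP := hermitian_spectral_diag_real hH; apply.
by rewrite {1}Me invmx_unitary // !mulmxA UUt mul1mx.
Qed.

Section Diagonalized.
Variables (n : nat) (M U : 'M[C]_n) (d : 'I_n -> R).
Hypotheses (UUt : U *m U ^t* = 1%:M) (UtU : U ^t* *m U = 1%:M).
Hypothesis UM : U *m M = diag_mx (\row_i (d i)%:C) *m U.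

Lemma rdot_unitary u v : rdot (U *m u) (U *m v) = rdot u v.
Proof. by rewrite rdot_adj mulmxA UtU mul1mx. Qed.

Lemma quadratic_diag y : rdot y (M *m y) =
  \sum_i d i * ComplexField.Normc.normc ((U *m y) i 0) ^+ 2.
Proof.
rewrite -rdot_unitary mulmxA UM -mulmxA rdotE; apply: eq_bigr => i _.
rewrite mul_diag_mx !mxE; case: (\sum_j _) => a b /=.
rewrite sqr_sqrtr ?addr_ge0 ?sqr_ge0 //; ring.
Qed.

Lemma rdot_diag y : rdot y y = 
  \sum_i ComplexField.Normc.normc ((U *m y) i 0) ^+ 2.
Proof.
rewrite -rdot_unitary -l2norm_sqr /l2norm sqr_sqrtr //.
by apply: sumr_ge0 => i _; rewrite sqr_ge0.
Qed.

Lemma rayleigh_ge c y : (forall i, c <= d i) -> c * rdot y y <= rdot y (M *m y).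
Proof.
move=> h; rewrite quadratic_diag rdot_diag mulr_sumr; apply: ler_sum => i _.
by apply: ler_wpM2r => //; rewrite sqr_ge0.
Qed.

Lemma rayleigh_le c y : (forall i, d i <= c) -> rdot y (M *m y) <= c * rdot y y.
Proof.
move=> h; rewrite quadratic_diag rdot_diag mulr_sumr; apply: ler_sum => i _.
by apply: ler_wpM2r => //; rewrite sqr_ge0.
Qed.

Lemma diag_eigenvector i : let v := U ^t* *m delta_mx i (0 : 'I_1) in
  rdot v v = 1 /\ M *m v = (d i)%:C *: v.
Proof.
move=> v; have Uv : U *m v = delta_mx i 0 by rewrite mulmxA UUt mul1mx.
split.
  rewrite rdot_diag Uv (bigD1 i) //= big1 => [|k ki].
    by rewrite mxE !eqxx ComplexField.Normc.normc1 addr0 expr1n.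
  by rewrite mxE (negPf ki) ComplexField.Normc.normc0 expr0n.
rewrite -[LHS]mul1mx -UtU -mulmxA (mulmxA U) UM -mulmxA Uv.
rewrite /v scalemxAr; congr (_ *m _).
apply/matrixP => k l; rewrite mul_diag_mx !mxE.
by case: eqVneq => [->|] //=; rewrite !mulr0.
Qed.

(** In the coordinates [U *m v], where [M] is diagonal, any nonzero coordinate
    of an eigenvector determines its eigenvalue. *)
Lemma eigenvector_diag (a : R) (v : 'cV[C]_n) :
  v != 0 -> M *m v = a%:C *: v -> exists i, a = d i.
Proof.
move=> v0 hv; have Uv0 : U *m v != 0.
  by apply: contra v0 => /eqP h; rewrite -[v]mul1mx -UtU -mulmxA h mulmx0.
have [i hi] : exists i, (U *m v) i 0 != 0.
  apply/existsP; apply: contraR Uv0; rewrite negb_exists => /forallP h.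
  by apply/eqP/colP => i; have := h i; rewrite negbK => /eqP ->; rewrite mxE.
exists i; have := congr1 (fun x : 'cV[C]_n => x i 0) (congr1 (mulmx U) hv).
rewrite mulmxA UM -mulmxA mul_diag_mx -scalemxAr !mxE.
move: hi; rewrite mxE => hi /(mulIf hi) [] //.
Qed.

(** [eigenvalue] speaks of row eigenvectors; conjugate transposition exchanges
    them with the column eigenvectors of the Hermitian [M]. *)
Lemma eigenvalue_diag (a : R) :
  M ^t* = M -> eigenvalue M a%:C <-> exists i, a = d i.
Proof.
move=> hM; split.
  case/eigenvalueP => v hv v0.
  apply: (@eigenvector_diag a (v ^t*)).
    by apply: contra v0 => /eqP h; rewrite -[v]trmxCK h trmx0 map_mx0.
  rewrite -[M in LHS]hM -trmxCM hv linearZ /= map_mxZ; congr (_ *: _).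
  exact: conjc_real.
case=> i ->; have [vv Mv] := diag_eigenvector i.
set v := U ^t* *m _ in vv Mv; apply/eigenvalueP; exists (v ^t*).
  rewrite -[M]hM -trmxCM Mv linearZ /= map_mxZ; congr (_ *: _).
  exact: conjc_real.
apply/eqP => h; move: vv; rewrite -[v]trmxCK h trmx0 map_mx0 rdot0r.
by move/eqP; rewrite eq_sym oner_eq0.
Qed.
End Diagonalized.

(** Makes the infimum and the supremum of a set of eigenvalues or singular
    values meaningful: outside bounded nonempty sets both have a default
    value. *)
Lemma codom_bounded n (d : 'I_n -> R) (E : set R) :
  (forall a, E a <-> exists i, a = d i) -> has_ubound E /\ has_lbound E.
Proof.
move=> hE; split.
  exists (\sum_i `|d i|) => a /hE [i ->]; rewrite (bigD1 i) //=.
  apply: le_trans (ler_norm _) _; rewrite lerDl; exact: sumr_ge0.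
exists (- \sum_i `|d i|) => a /hE [i ->]; rewrite lerNl (bigD1 i) //=.
rewrite -normrN; apply: le_trans (ler_norm _) _; rewrite lerDl; exact: sumr_ge0.
Qed.

Lemma lambda_min_le n (M : 'M[C]_n) (y : 'cV[C]_n) : M ^t* = M ->
  lambda_min M * rdot y y <= rdot y (M *m y).
Proof.
move=> hM; have [U [d [h1 h2 h3]]] := hermitian_diagonalization hM.
have ev a := eigenvalue_diag h1 h2 h3 a hM.
apply: (rayleigh_ge h2 h3) => i; apply: ge_inf; last by apply/ev; exists i.
exact: (codom_bounded ev).2.
Qed.

Lemma lambda_max_ge n (M : 'M[C]_n) (y : 'cV[C]_n) : M ^t* = M ->
  rdot y (M *m y) <= lambda_max M * rdot y y.
Proof.
move=> hM; have [U [d [h1 h2 h3]]] := hermitian_diagonalization hM.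
have ev a := eigenvalue_diag h1 h2 h3 a hM.
apply: (rayleigh_le h2 h3) => i; apply: ub_le_sup; last by apply/ev; exists i.
exact: (codom_bounded ev).1.
Qed.

Lemma l2norm1P n (v : 'cV[C]_n) : l2norm v = 1 <-> rdot v v = 1.
Proof.
rewrite -l2norm_sqr; split=> [->|/eqP]; first by rewrite expr1n.
by rewrite sqrp_eq1 ?l2norm_ge0 // => /eqP.
Qed.

Lemma full_column_rank_inj n d (A : 'M[C]_(n, d)) (v : 'cV[C]_d) :
  \rank A = d -> A *m v = 0 -> v = 0.
Proof.
move=> rA Av; apply: trmx_inj; rewrite trmx0.
have /row_free_inj : row_free A^T by rewrite /row_free mxrank_tr rA.
by apply; rewrite -trmx_mul Av mul0mx trmx0.
Qed.

(** * Singular values *)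

(** For [A] of full column rank, every eigenvalue of [A ^t* *m A] is positive and
    the singular values of [A] are exactly their square roots; Rayleigh bounds
    for [A ^t* *m A] are then bounds on [|A x|]. *)
Lemma singular_values_bounds n d (A : 'M[C]_(n, d)) :
  (0 < d)%N -> \rank A = d ->
  [/\ 0 < sigma_min A,
      forall x, sigma_min A ^+ 2 * rdot x x <= rdot (A *m x) (A *m x),
      0 <= spectral_norm A & spectral_norm A <= sigma_max A].
Proof.
move=> d0 rA; pose M := A ^t* *m A.
have hM : M ^t* = M by rewrite trmxCM trmxCK.
have [U [e [h1 h2 h3]]] := hermitian_diagonalization hM.
have qM x : rdot x (M *m x) = rdot (A *m x) (A *m x).
  by rewrite /M -mulmxA [LHS]rdot_adj trmxCK.
have e_gt0 i : 0 < e i.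
  have [] := diag_eigenvector h1 h2 h3 i; set v := _ *m _ => vv Mv.
  have ei : e i = rdot (A *m v) (A *m v) by rewrite -qM Mv rdotZr vv mulr1.
  rewrite ei lt_neqAle rdot_ge0 andbT eq_sym.
  apply/eqP => /rdot_eq0 /(full_column_rank_inj rA) v0.
  move: vv; rewrite v0 rdot0r => /eqP.
  by rewrite eq_sym oner_eq0.
have sv a : singular_value A a <-> exists i, a = Num.sqrt (e i).
  split.
    case=> a0 [u [v [u1 /l2norm1P v1 Av Au]]].
    have v0 : v != 0.
      apply/eqP => v0; move: v1; rewrite v0 rdot0r => /eqP.
      by rewrite eq_sym oner_eq0.
    have Mv : M *m v = (a ^+ 2)%:C *: v.
      by rewrite /M -mulmxA Av -scalemxAr Au scalerA -rmorphM /= expr2.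
    have [i hi] := eigenvector_diag h2 h3 v0 Mv.
    by exists i; rewrite -hi sqrtr_sqr ger0_norm.
  case=> i ->; split; first exact: sqrtr_ge0.
  have [] := diag_eigenvector h1 h2 h3 i; set v := _ *m _ => vv Mv.
  have s0 : Num.sqrt (e i) != 0 by rewrite gt_eqF ?sqrtr_gt0.
  have s2 : Num.sqrt (e i) ^+ 2 = e i by rewrite sqr_sqrtr ?ltW.
  (* The left singular vector of a right singular vector v is A v / sqrt (e i). *)
  exists (((Num.sqrt (e i))^-1)%:C *: (A *m v)), v; split.
  - apply/l2norm1P; rewrite rdotZl rdotZr -qM Mv rdotZr vv -{3}s2 mulr1.
    by field.
  - exact/l2norm1P.
  - by rewrite scalerA -rmorphM /= divff // scale1r.
  - rewrite -scalemxAr mulmxA Mv scalerA -rmorphM /= -{2}s2.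
    by rewrite expr2 mulrA mulVf ?mul1r.
have [ub lb] := codom_bounded sv.
have i0 : 'I_d by exists 0%N.
have smin : 0 < sigma_min A.
  have [i _ hi] := arg_minP e (isT : xpredT i0).
  have : Num.sqrt (e i) <= sigma_min A.
    apply: lb_le_inf; first by exists (Num.sqrt (e i)); apply/sv; exists i.
    by move=> _ /sv[k ->]; rewrite ler_wsqrtr ?hi.
  by apply: lt_le_trans; rewrite sqrtr_gt0.
have smin_le x : sigma_min A ^+ 2 * rdot x x <= rdot (A *m x) (A *m x).
  rewrite -qM; apply: (rayleigh_ge h2 h3) => i.
  rewrite -[X in _ <= X](sqr_sqrtr (ltW (e_gt0 i))).
  rewrite ler_sqr ?nnegrE ?sqrtr_ge0 ?(ltW smin) //.
  by apply: ge_inf => //; apply/sv; exists i.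
have smax i : Num.sqrt (e i) <= sigma_max A.
  by apply: ub_le_sup => //; apply/sv; exists i.
have smax0 : 0 <= sigma_max A by apply: le_trans (smax i0); exact: sqrtr_ge0.
pose E := [set l2norm (A *m x) | x in [set x | l2norm x <= 1]].
have E0 : E 0 by exists 0; rewrite /= ?mulmx0 l2norm_rdot rdot0r sqrtr0.
have Ele : ubound E (sigma_max A).
  move=> _ [x /= x1 <-]; rewrite -ler_sqr ?nnegrE ?l2norm_ge0 // l2norm_sqr -qM.
  apply: (@le_trans _ _ (sigma_max A ^+ 2 * rdot x x)).
    apply: (rayleigh_le h2 h3) => i.
    by rewrite -[X in X <= _](sqr_sqrtr (ltW (e_gt0 i)))
       ler_sqr ?nnegrE ?sqrtr_ge0.
  rewrite -[leRHS]mulr1; apply: ler_wpM2l; first exact: sqr_ge0.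
  by rewrite -l2norm_sqr expr_le1 ?l2norm_ge0.
split=> //.
- by apply: ub_le_sup => //; exists (sigma_max A).
- by apply: ge_sup => //; exists 0.
Qed.
End Spectral.

(** * One block Kaczmarz step *)

Section BlockStep.
Local Open Scope classical_set_scope.
Local Open Scope complex_scope.
Local Open Scope sesquilinear_scope.
Variable R : realType.
Local Notation C := R[i].

Section OneBlock.
Variables (k d : nat) (B : 'M[C]_(k, d)) (alpha beta : R).
Hypotheses (alpha_gt0 : 0 < alpha) (beta_gt0 : 0 < beta).
Hypothesis lower : forall w, alpha * rdot w w <= rdot (B ^t* *m w) (B ^t* *m w).
Hypothesis upper : forall w, rdot (B ^t* *m w) (B ^t* *m w) <= beta * rdot w w.

Lemma gram_unit : B *m B ^t* \in unitmx.
Proof.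
rewrite -row_free_unit; apply: inj_row_free => v hv.
have hw : B *m B ^t* *m v ^t* = 0.
  have := congr1 (fun x : 'rV[C]_k => x ^t*) hv.
  by rewrite !trmxCM trmxCK trmx0 map_mx0.
have w0 : rdot (v ^t*) (v ^t*) = 0.
  apply/eqP; rewrite eq_le rdot_ge0 andbT.
  have := lower (v ^t*).
  rewrite rdot_adj trmxCK mulmxA hw rdot0l.
  by rewrite pmulr_rle0.
by rewrite -[v]trmxCK (rdot_eq0 w0) trmx0 map_mx0.
Qed.

(** The Gram matrix [G = B *m B ^t*] of the rows being invertible,
    [B ^t* *m invmx G] satisfies the four Penrose equations, so the
    pseudoinverse is not a default value. *)
Lemma pseudoinverseP : is_pseudoinverse B (pseudoinverse B).
Proof.
apply: xgetPex; exists (B ^t* *m invmx (B *m B ^t*)).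
have hG : (B *m B ^t*) ^t* = B *m B ^t* by rewrite trmxCM trmxCK.
have BX : B *m (B ^t* *m invmx (B *m B ^t*)) = 1%:M.
  by rewrite mulmxA mulmxV ?gram_unit.
split.
- by rewrite BX mul1mx.
- by rewrite -mulmxA BX mulmx1.
- by rewrite BX trmxC1.
- rewrite !trmxCM trmxCK mulmxA; congr (_ *m _ *m _).
  by rewrite trmx_inv map_invmx hG.
Qed.

Let X := pseudoinverse B.

(** With [z = X *m f], the vector [w = X ^t* *m z] satisfies [z = B ^t* *m w] and
    [<f, w> = |z|^2].  Expanding [0 <= |f - alpha w|^2] and using
    [alpha |w|^2 <= |z|^2] gives [alpha |z|^2 <= |f|^2]. *)
Lemma pinv_norm_le f : rdot (X *m f) (X *m f) <= rdot f f / alpha.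
Proof.
have [_ XBX _ hXB] := pseudoinverseP; rewrite -/X in XBX hXB.
rewrite ler_pdivlMr // mulrC; set z := X *m f; pose w := X ^t* *m z.
have zw : z = B ^t* *m w.
  by rewrite /w mulmxA -trmxCM hXB /z mulmxA XBX.
have fw : rdot f w = rdot z z by rewrite /w rdot_adj trmxCK.
have lw := lower w; rewrite -zw in lw.
have := rdot_ge0 (f - alpha%:C *: w).
rewrite rdotDr !rdotDl !rdotNr !rdotNl !rdotZr !rdotZl (rdotC w) fw => h.
have := ler_wpM2l (ltW alpha_gt0) lw. lra.
Qed.

(** The bound on [B ^t*] passes to [B] by expanding
    [0 <= |beta u - B ^t* B u|^2]. *)
Lemma block_norm_le u : rdot (B *m u) (B *m u) <= beta * rdot u u.
Proof.
have uw := upper (B *m u).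
have := rdot_ge0 (beta%:C *: u - B ^t* *m (B *m u)).
rewrite rdotDr !rdotDl !rdotNr !rdotNl !rdotZr !rdotZl (rdotC _ u).
rewrite (rdot_adj (B ^t*) u) trmxCK => h.
rewrite -(ler_pM2l beta_gt0); nra.
Qed.

(** [X *m B] is a Hermitian projection [p] that fixes the range of [X]: hence
    [u - p u] is orthogonal to [X *m f], and [|u - p u|^2 = |u|^2 - |p u|^2], where
    [|p u|^2 >= |B u|^2 / beta] because [B *m p u = B *m u]. *)
Lemma block_update_le u f :
  rdot (u - X *m (B *m u) + X *m f) (u - X *m (B *m u) + X *m f)
  <= rdot u u - rdot (B *m u) (B *m u) / beta + rdot f f / alpha.
Proof.
have [BXB XBX _ hXB] := pseudoinverseP; rewrite -/X in BXB XBX hXB.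
set p := X *m (B *m u); set z := X *m f.
have selfadj v w : rdot v (X *m (B *m w)) = rdot (X *m (B *m v)) w.
  by rewrite mulmxA rdot_adj hXB mulmxA.
have pz : X *m (B *m z) = z by rewrite /z !mulmxA XBX.
have pp : X *m (B *m p) = p by rewrite /p !mulmxA XBX.
have up : rdot u p = rdot p p by rewrite -[in LHS]pp selfadj.
have uz : rdot u z = rdot p z by rewrite -[in LHS]pz selfadj.
have Bp : B *m p = B *m u by rewrite /p !mulmxA BXB.
have hp : rdot (B *m u) (B *m u) / beta <= rdot p p.
  by rewrite ler_pdivrMr // mulrC -Bp block_norm_le.
have hz := pinv_norm_le f; rewrite -/z in hz.
rewrite !(rdotDr, rdotDl, rdotNr, rdotNl) (rdotC z u) (rdotC z p) (rdotC p u).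
rewrite up uz; lra.
Qed.
End OneBlock.

Lemma rdot_rowblock_sum n (T : {set {set 'I_n}}) (v : 'cV[C]_n) :
  finset.partition T [set: 'I_n]%SET ->
  \sum_(tau in T) rdot (rowblock tau v) (rowblock tau v) = rdot v v.
Proof.
case/and3P => /eqP cT triv _.
rewrite rdotE.
rewrite [RHS](eq_bigl (fun i => i \in finset.cover T)) => [|i];
  last by rewrite cT finset.in_setT.
rewrite finset.big_trivIset //; apply: eq_bigr => tau _.
by rewrite rdotE big_enum_val; apply: eq_bigr => i _; rewrite !mxE.
Qed.

Lemma rowblock_mul n d (tau : {set 'I_n}) (A : 'M[C]_(n, d)) (u : 'cV[C]_d) :
  rowblock tau (A *m u) = rowblock tau A *m u.
Proof. by rewrite /rowblock mul_rowsub_mx. Qed.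

Definition kaczmarz_step n d (A : 'M[C]_(n, d)) (b : 'cV[C]_n)
    (tau : {set 'I_n}) (x : 'cV[C]_d) : 'cV[C]_d :=
  x + pseudoinverse (rowblock tau A) *m (rowblock tau b - rowblock tau A *m x).

(** Each row lies in exactly one block, so the gains [|B u|^2] and the noise terms
    of the single blocks add up to [|A u|^2] and to the full squared residual. *)
Lemma paving_step_sum n d (A : 'M[C]_(n, d)) b m (alpha beta : R) T x xstar :
  row_paving A m alpha beta T -> 0 < alpha -> 0 < beta ->
  \sum_(tau in T) rdot (kaczmarz_step A b tau x - xstar)
                       (kaczmarz_step A b tau x - xstar)
  <= m%:R * rdot (x - xstar) (x - xstar)
     - rdot (A *m (x - xstar)) (A *m (x - xstar)) / beta
     + rdot (A *m xstar - b) (A *m xstar - b) / alpha.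
Proof.
move=> [pT cT hT] a0 b0.
pose u := x - xstar; pose e := b - A *m xstar.
have -> : rdot (A *m xstar - b) (A *m xstar - b) = rdot e e.
  by rewrite -opprB rdotNl rdotNr opprK.
rewrite -!(rdot_rowblock_sum _ pT) -cT -sumr_const mulr_suml.
rewrite !mulr_suml -sumrB -big_split /=; apply: ler_sum => tau tT.
have [lo up] := hT _ tT; set B := rowblock tau A in lo up *.
have hG : (B *m B ^t*) ^t* = B *m B ^t* by rewrite trmxCM trmxCK.
have qG w : rdot (B ^t* *m w) (B ^t* *m w) = rdot w (B *m B ^t* *m w).
  by rewrite -mulmxA [RHS]rdot_adj.
have lower w : alpha * rdot w w <= rdot (B ^t* *m w) (B ^t* *m w).
  rewrite qG; apply: le_trans (lambda_min_le w hG).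
  by apply: ler_wpM2r => //; exact: rdot_ge0.
have upper w : rdot (B ^t* *m w) (B ^t* *m w) <= beta * rdot w w.
  rewrite qG; apply: le_trans (lambda_max_ge w hG) _.
  by apply: ler_wpM2r => //; exact: rdot_ge0.
have blockB : rowblock tau e = rowblock tau b - B *m xstar.
  by rewrite -rowblock_mul; apply/matrixP => i l; rewrite !mxE.
have -> : kaczmarz_step A b tau x - xstar =
    u - pseudoinverse B *m (B *m u) + pseudoinverse B *m rowblock tau e.
  rewrite blockB /kaczmarz_step -/B /u !mulmxBr opprB -[RHS]addrA.
  by rewrite [X in _ = _ + X]addrC subrKA addrAC.
rewrite mul1r rowblock_mul.
exact: block_update_le.
Qed.
End BlockStep.

(** * Expectations over finitely many independent uniform draws *)

Section FiniteDraws.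
Local Open Scope classical_set_scope.
Local Open Scope complex_scope.
Local Open Scope sesquilinear_scope.
Variables (S : finType).

Lemma sum_tuple_cons (V : nmodType) j (F : j.+1.-tuple S -> V) :
  \sum_t F t = \sum_s \sum_(t : j.-tuple S) F [tuple of s :: t].
Proof.
rewrite pair_bigA /=.
rewrite (reindex (fun st : S * j.-tuple S => [tuple of st.1 :: st.2])) //.
exists (fun t => (thead t, [tuple of behead t])) => [[s t]|t] _ /=.
  by congr pair; apply: val_inj.
by rewrite -tuple_eta.
Qed.

(** If one random step sends [D] to at most [q * D + (1 - q) * N] on average,
    then [D - N] contracts by [q] at each step.  The induction conditions on the
    first draw and applies the hypothesis for the remaining ones from the new
    starting point; [q >= 0] lets the one-step bound be multiplied by
    [q ^+ j]. *)
Lemma iterated_contraction (R : realDomainType) (X : Type) (step : S -> X -> X)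
    (D : X -> R) (p : S -> R) (q N : R) :
  (forall s, 0 <= p s) -> \sum_s p s = 1 -> 0 <= q ->
  (forall x, \sum_s p s * D (step s x) <= q * D x + (1 - q) * N) ->
  forall j x, \sum_(t : j.-tuple S)
      (\prod_(k < j) p (tnth t k)) * D (foldl (fun y s => step s y) x t)
    <= q ^+ j * D x + (1 - q ^+ j) * N.
Proof.
move=> p0 p1 q0 hstep; elim=> [|j IH] x.
  rewrite (bigD1 [tuple]) //= [X in _ + X]big1 => [|t];
    last by case/eqP; exact: tuple0.
  by rewrite big_ord0 !mul1r subrr mul0r addr0.
rewrite sum_tuple_cons.
apply: (@le_trans _ _
  (\sum_s p s * (q ^+ j * D (step s x) + (1 - q ^+ j) * N))).
  apply: ler_sum => s _; apply: le_trans (ler_wpM2l (p0 s) (IH (step s x))).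
  rewrite mulr_sumr; apply/ler_sum => t _ /=.
  rewrite big_ord_recl mulrA tnth0.
  have E (k : 'I_j) : p (tnth [tuple of s :: t] (lift ord0 k)) = p (tnth t k).
    by rewrite !(tnth_nth s).
  by rewrite (eq_bigr _ (fun k _ => E k)).
under eq_bigr do rewrite mulrDr mulrCA.
rewrite big_split /= -mulr_sumr -mulr_suml p1 mul1r.
have := ler_wpM2l (exprn_ge0 j q0) (hstep x); rewrite exprS; lra.
Qed.

Variables (disp : measure_display) (Omega : measurableType disp).
Variables (R : realType) (P : probability Omega R).

Lemma expectation_finite (I : finType) (g : Omega -> I) (F : I -> R) :
  (forall i, 0 <= F i) -> (forall i, measurable (g @^-1` [set i])) ->
  ('E_P[fun w => F (g w)] = \sum_i (F i)%:E * P (g @^-1` [set i]))%E.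
Proof.
move=> F0 mg; rewrite unlock.
pose f i w : \bar R := ((F i)%:E * (\1_(g @^-1` [set i]) w)%:E)%E.
rewrite (eq_integral (fun w => \sum_i f i w)%E); last first.
  move=> w _; rewrite (bigD1 (g w)) //= big1 => [|i ig].
    by rewrite adde0 /f indicE mem_set // mule1.
  rewrite /f indicE memNset ?mule0 // => /= gi.
  by move: ig; rewrite gi eqxx.
rewrite (ge0_integral_sum P measurableT (f := f)); first last.
- by move=> i w _; rewrite mule_ge0 ?lee_fin.
- move=> i; apply: measurable_funeM; apply/measurable_EFinP.
  exact: measurable_indic.
apply: eq_bigr => i _; rewrite /f ge0_integralZl_EFin //; last first.
- by apply/measurable_EFinP; exact: measurable_indic.
- by rewrite integral_indic // setIT.
Qed.

Variables (T : {set S}) (tau : nat -> Omega -> S).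
Hypothesis iid : iid_uniform P T tau.
Hypothesis T0 : (0 < #|T|)%N.

Definition uniform_weight (s : S) : R := if s \in T then #|T|%:R^-1 else 0.

Lemma uniform_weight_ge0 s : 0 <= uniform_weight s.
Proof. by rewrite /uniform_weight; case: ifP => // _; rewrite invr_ge0. Qed.

Lemma sum_uniform_weight (D : S -> R) :
  \sum_s uniform_weight s * D s = #|T|%:R^-1 * \sum_(s in T) D s.
Proof.
rewrite mulr_sumr [RHS]big_mkcond /=; apply: eq_bigr => s _.
by rewrite /uniform_weight; case: ifP; rewrite ?mul0r.
Qed.

Lemma uniform_weight_sum1 : \sum_s uniform_weight s = 1.
Proof.
under eq_bigr do rewrite -[uniform_weight _]mulr1.
by rewrite sum_uniform_weight sumr_const mulVf // pnatr_eq0 -lt0n.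
Qed.

(** The draws outside [T] have probability zero because those in [T] already
    carry total mass one. *)
Lemma draw_probability k s : P (tau k @^-1` [set s]) = (uniform_weight s)%:E.
Proof.
have [mtau Pt _] := iid.
rewrite /uniform_weight; case: ifPn => [/Pt -> //|sT].
have mk i : measurable (tau k @^-1` [set i]) by exact: mtau.
(* The expectation of the constant 1 expresses that the masses add up to 1. *)
have := @expectation_finite S (tau k) (fun=> 1) (fun=> ler01) mk.
rewrite expectation_cst (bigID (mem T)) /=.
rewrite (eq_bigr (fun=> (#|T|%:R^-1)%:E)); last by move=> t /Pt ->; rewrite mul1e.
rewrite sumEFin sumr_const -[_ *+ #|T|]mulr_natl divff ?pnatr_eq0 -?lt0n //.
move=> e.
have e0 : (\sum_(i | i \notin T) 1%:E * P (tau k @^-1` [set i]) = 0%R%:E)%E.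
  by move: e; case: (\sum_(i | _) _)%E => [r| |] //= [] h; congr EFin; lra.
apply/eqP; rewrite eq_le measure_ge0 andbT -e0 (bigD1 s) //= mul1e leeDl //.
by apply: sume_ge0 => i _; rewrite mul1e.
Qed.

(** The event that the first [j] draws form a given tuple is the intersection
    over the times below [j] to which the product rule applies. *)
Lemma draws_probability j (t : j.-tuple S) :
  measurable ((fun w => [tuple of mkseq (tau^~ w) j]) @^-1` [set t]) /\
  P ((fun w => [tuple of mkseq (tau^~ w) j]) @^-1` [set t]) =
    (\prod_(k < j) uniform_weight (tnth t k))%:E.
Proof.
have [mtau _ ind] := iid.
(* Times outside [0, j) are unconstrained; they are not in [J]. *)
pose B (k : nat) : set S := if insub k is Some i then [set tnth t i] else setT.
pose J := [fset k | k in iota 0 j]%fset.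
have JE k : (k \in J) = (k < j)%N by rewrite in_fset /= mem_iota add0n.
have -> : (fun w => [tuple of mkseq (tau^~ w) j]) @^-1` [set t] =
    \bigcap_(k in [set` J]) (tau k @^-1` B k).
  apply/seteqP; split=> w /=.
    move=> gt k /=; rewrite JE => kj; rewrite /B insubT /= -gt.
    by rewrite (tnth_nth (tau 0 w)) /= nth_mkseq.
  move=> h; apply: eq_from_tnth => i.
  have := h i; rewrite /= JE ltn_ord => /(_ isT); rewrite /B valK /= => <-.
  by rewrite (tnth_nth (tau 0 w)) /= nth_mkseq.
split.
  apply: fin_bigcap_measurable => [|k _]; first exact: finite_fset.
  exact: mtau.
rewrite ind -prodEFin.
rewrite (perm_big (iota 0 j)) /=; last first.
  apply: uniq_perm; [exact: fset_uniq | exact: iota_uniq |] => k.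
  by rewrite JE mem_iota add0n.
rewrite -[X in iota _ X]subn0 -/(index_iota 0 j) big_mkord.
by apply: eq_bigr => k _; rewrite /B valK draw_probability.
Qed.

Lemma expectation_draws j (G : seq S -> R) : (forall s, 0 <= G s) ->
  ('E_P[fun w => G (mkseq (tau^~ w) j)] =
   (\sum_(t : j.-tuple S)
      (\prod_(k < j) uniform_weight (tnth t k)) * G t)%:E)%E.
Proof.
move=> G0.
rewrite (expectation_finite (g := fun w => [tuple of mkseq (tau^~ w) j])
  (F := fun t : j.-tuple S => G t)) //; last first.
  by move=> t; have [] := draws_probability t.
rewrite -sumEFin; apply: eq_bigr => t _.
by have [_ ->] := draws_probability t; rewrite EFinM muleC.
Qed.
End FiniteDraws.

(** * Convergence of randomized block Kaczmarz *)

Lemma block_kaczmarz_foldl (R : realType) n d (A : 'M[R[i]]_(n, d)) b x0 tau j :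
  block_kaczmarz A b x0 tau j =
  foldl (fun y s => kaczmarz_step A b s y) x0 (mkseq tau j).
Proof. by elim: j => // j IH; rewrite mkseqS foldl_rcons -IH. Qed.

Lemma paving_card_gt0 (R : realType) n d (A : 'M[R[i]]_(n, d)) m alpha beta T :
  (0 < n)%N -> row_paving A m alpha beta T -> (0 < #|T|)%N.
Proof.
move=> n0 [/and3P[/eqP cT _ _] _ _]; rewrite lt0n cards_eq0.
apply/eqP => T0; have := finset.in_setT (Ordinal n0).
by rewrite -cT T0 /finset.cover big_set0 finset.in_set0.
Qed.

(** Convergence for any paving and any lower bound [s] on the singular values.
    That the rate [q] is nonnegative follows from the one-step inequality itself,
    applied to the noiseless system with solution [0]: its left-hand side is a
    sum of squares, and its right-hand side is at most [q * m] times the squared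
    norm of the starting point. *)
Lemma kaczmarz_expectation_le (R : realType) n d (A : 'M[R[i]]_(n, d)) m
    (alpha beta s : R) T b xstar x0 (disp : measure_display)
    (Omega : measurableType disp) (P : probability Omega R)
    (tau : nat -> Omega -> {set 'I_n}) j (q := 1 - s ^+ 2 / (beta * m%:R)) :
  row_paving A m alpha beta T -> (0 < m)%N -> (0 < d)%N ->
  0 < alpha -> 0 < beta -> 0 < s ->
  (forall x, s ^+ 2 * rdot x x <= rdot (A *m x) (A *m x)) ->
  iid_uniform P T tau ->
  0 <= q /\
  ('E_P[fun w => (l2norm (block_kaczmarz A b x0 (tau^~ w) j - xstar) ^+ 2)%R]
   <= (q ^+ j * l2norm (x0 - xstar) ^+ 2 +
       (1 - q ^+ j) *
       (beta / alpha * (l2norm (A *m xstar - b) ^+ 2 / s ^+ 2)))%R%:E)%E.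
Proof.
move=> pav m0 d0 a0 b0 s0 hs iid.
have cT : #|T| = m by case: pav.
have mR : 0 < m%:R :> R by rewrite ltr0n.
have q0 : 0 <= q.
  (* The constant vector serves as a nonzero starting point. *)
  have v0 : 0 < rdot (const_mx 1 : 'cV[R[i]]_d) (const_mx 1).
    rewrite rdotE (eq_bigr (fun=> 1)) ?sumr_const ?card_ord ?ltr0n // => i _.
    by rewrite !mxE /=; ring.
  have := paving_step_sum 0 (const_mx 1) 0 pav a0 b0.
  rewrite mulmx0 !subr0 rdot0r mul0r addr0 => h.
  have {}h : 0 <= m%:R * rdot (const_mx 1 : 'cV[R[i]]_d) (const_mx 1)
      - rdot (A *m const_mx 1) (A *m const_mx 1) / beta.
    by apply: le_trans h; apply: sumr_ge0 => t _; exact: rdot_ge0.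
  rewrite subr_ge0 ler_pdivrMr ?mulr_gt0 // mul1r -(ler_pM2r v0).
  apply: le_trans (hs _) _.
  move: h; rewrite subr_ge0 ler_pdivrMr // => /le_trans; apply.
  by rewrite [_ * beta]mulrC mulrA.
split=> //.
pose D (x : 'cV[R[i]]_d) := l2norm (x - xstar) ^+ 2.
under [X in expectation _ X]eq_fun do rewrite block_kaczmarz_foldl.
rewrite (expectation_draws iid _ _
  (G := fun w => D (foldl (fun y t => kaczmarz_step A b t y) x0 w))); first last.
- by move=> w; exact: sqr_ge0.
- by rewrite cT.
rewrite lee_fin.
apply: (iterated_contraction (D := D)) => //.
- exact: uniform_weight_ge0.
- by apply: uniform_weight_sum1; rewrite cT.
move=> x; rewrite sum_uniform_weight cT /D.
under eq_bigr do rewrite l2norm_sqr.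
rewrite !l2norm_sqr.
have h1 := paving_step_sum b x xstar pav a0 b0.
have h2 : s ^+ 2 * rdot (x - xstar) (x - xstar) / beta <=
    rdot (A *m (x - xstar)) (A *m (x - xstar)) / beta.
  by rewrite ler_pM2r ?invr_gt0.
rewrite mulrC ler_pdivrMr //.
apply: le_trans h1 _.
have -> : (q * rdot (x - xstar) (x - xstar) + (1 - q) *
   (beta / alpha * (rdot (A *m xstar - b) (A *m xstar - b) / s ^+ 2))) * m%:R
 = m%:R * rdot (x - xstar) (x - xstar)
   - s ^+ 2 * rdot (x - xstar) (x - xstar) / beta
   + rdot (A *m xstar - b) (A *m xstar - b) / alpha.
  by rewrite /q; field; rewrite !gt_eqF.
lra.
Qed.

Theorem corollary1p4 (R : realType) (Cpave : R) (hC : paving_constant Cpave)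
  (n d : nat) (A : 'M[R[i]]_(n, d)) (hstd : standardized A)
  (hrank : \rank A = d)
  (m : nat) (alpha beta : R) (T : {set {set 'I_n}})
  (hT : row_paving A m alpha beta T)
  (hm : m%:R <= 4 * Cpave * spectral_norm A ^+ 2 * ln (1 + n%:R))
  (halpha : 1 / 2 <= alpha) (halphabeta : alpha <= beta) (hbeta : beta <= 3 / 2)
  (b : 'cV[R[i]]_n) (xstar : 'cV[R[i]]_d)
  (hxstar : least_squares_minimizer A b xstar)
  (x0 : 'cV[R[i]]_d)
  (disp : measure_display) (Omega : measurableType disp)
  (P : probability Omega R)
  (tau : nat -> Omega -> {set 'I_n}) (htau : iid_uniform P T tau) (j : nat) :
  ('E_P[fun w : Omega =>
      (l2norm (block_kaczmarz A b x0 (fun k => tau k w) j - xstar) ^+ 2)%R]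
   <= ((1 - (6 * Cpave * kappa A ^+ 2 * ln (1 + n%:R))^-1) ^+ j
         * l2norm (x0 - xstar) ^+ 2
       + 3 * l2norm (A *m xstar - b) ^+ 2 / sigma_min A ^+ 2)%R%:E)%E.
Proof.
have [d0|d_gt0] := posnP d.
  (* Without columns every iterate is the zero-dimensional vector. *)
  have z (v : 'cV[R[i]]_d) : l2norm v ^+ 2 = 0.
    by move: v; rewrite d0 => v; rewrite l2norm_sqr rdotE big_ord0.
  under [X in expectation _ X]eq_fun do rewrite z.
  rewrite expectation_cst lee_fin z mulr0 add0r.
  by rewrite divr_ge0 ?sqr_ge0 // mulr_ge0 ?sqr_ge0.
have n_gt0 : (0 < n)%N.
  by apply: leq_trans d_gt0 _; rewrite -hrank rank_leq_row.
have cT : #|T| = m by case: hT.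
have m_gt0 : (0 < m)%N by rewrite -cT (paving_card_gt0 n_gt0 hT).
have a0 : 0 < alpha by lra.
have b0 : 0 < beta by lra.
have [s0 hs spec0 spec_le] := singular_values_bounds d_gt0 hrank.
have [q0] := kaczmarz_expectation_le b xstar x0 j hT m_gt0 d_gt0 a0 b0 s0 hs htau.
set q := (1 - sigma_min A ^+ 2 / _) in q0 *.
move/le_trans; apply; rewrite lee_fin.
have mR : 0 < m%:R :> R by rewrite ltr0n.
have [C0 _] := hC.
have L0 : 0 < ln (1 + n%:R : R) by rewrite ln_gt0 // ltrDl ltr0n.
have bm : beta * m%:R <= 6 * Cpave * sigma_max A ^+ 2 * ln (1 + n%:R).
  have spec2 : spectral_norm A ^+ 2 <= sigma_max A ^+ 2.
    by rewrite ler_sqr ?nnegrE // (le_trans spec0).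
  have h : beta * m%:R <= 3 / 2 * (4 * Cpave * spectral_norm A ^+ 2 * ln (1 + n%:R)).
    by apply: ler_pM => //; exact: ltW.
  apply: le_trans h _.
  have : Cpave * ln (1 + n%:R) * spectral_norm A ^+ 2 <=
         Cpave * ln (1 + n%:R) * sigma_max A ^+ 2.
    by rewrite ler_pM2l ?mulr_gt0.
  lra.
have bm0 : 0 < beta * m%:R by rewrite mulr_gt0.
have qle : q <= 1 - (6 * Cpave * kappa A ^+ 2 * ln (1 + n%:R))^-1.
  rewrite lerD2l lerN2 /kappa.
  have -> : (6 * Cpave * (sigma_max A / sigma_min A) ^+ 2 * ln (1 + n%:R))^-1
     = sigma_min A ^+ 2 / (6 * Cpave * sigma_max A ^+ 2 * ln (1 + n%:R)).
    by rewrite -[RHS]invrK invf_div exprMn exprVn; congr (_^-1); ring.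
  rewrite ler_pM2l ?exprn_gt0 // lef_pV2 ?posrE //.
  exact: lt_le_trans bm.
apply: lerD.
  by rewrite ler_wpM2r ?sqr_ge0 // lerXn2r ?nnegrE // (le_trans q0).
have e0 : 0 <= l2norm (A *m xstar - b) ^+ 2 / sigma_min A ^+ 2.
  by rewrite divr_ge0 ?sqr_ge0.
rewrite -[in leRHS]mulrA.
have ba : beta / alpha <= 3 by rewrite ler_pdivrMr //; lra.
have ba0 : 0 <= beta / alpha by rewrite divr_ge0 ?ltW.
apply: (@le_trans _ _
  (beta / alpha * (l2norm (A *m xstar - b) ^+ 2 / sigma_min A ^+ 2))).
  by apply: ler_piMl; [exact: mulr_ge0 | rewrite gerBl exprn_ge0].
by rewrite ler_wpM2r.
Qed.
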